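(* Let $n\ge2$ and $m\ge1$ be integers with $\gcd(n,m!)=1$. Then $\mathsf{D}_m(\mathbb{Z}_n)\le\mathsf{D}(\mathbb{Z}_n^{t(m)})+m-1$.
   Context: A sequence over $\mathbb{Z}_n$ is a finite multiset of elements; its length counts multiplicity, and a subsequence is a sub-multiset. For $S=(a_1,\dots,a_\ell)$, $e_m(S)=\sum_{1\le i_1<\dots<i_m\le\ell}\prod_{j=1}^m a_{i_j}$. $\mathsf{D}_m(\mathbb{Z}_n)$ is the smallest positive integer $t$ such that every sequence $S$ over the ring $\mathbb{Z}_n$ with $|S|\ge t$ contains a subsequence $S'$ with $|S'|\ge m$ and $e_m(S')=0$. $\mathsf{D}(G)$ is the Davenport constant of a finite abelian group $G$: the smallest positive integer $t$ such that every sequence over $G$ of length at least $t$ has a non-empty zero-sum subsequence; $\mathbb{Z}_n^{t(m)}$ is the direct sum of $t(m)$ copies of $\mathbb{Z}_n$. Here $t(m)$ is defined as follows: let $\Sigma_m$ be the set of tuples $(j_1,\dots,j_m)$ of non-negative integers with $j_1+2j_2+\cdots+mj_m=m$ (indexing the terms $\prod_i\frac{(-p_i)^{j_i}}{j_i!i^{j_i}}$ of the Girard–Newton expression of $e_m$ in power sums $p_i$); a set $T\subseteq\{1,\dots,m\}$ is dominating if every tuple in $\Sigma_m$ has $j_i\ge1$ for some $i\in T$; $t(m)$ is the minimum size of a dominating set (it equals $\lfloor m/2\rfloor+1$). *)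

(* Defs.v *)
From HB Require Import structures.
From mathcomp Require Import all_boot all_order all_algebra.
From mathcomp Require Import boolp.

Set Implicit Arguments.
Unset Strict Implicit.
Unset Printing Implicit Defensive.

Import GRing.Theory.
Local Open Scope ring_scope.

(* Multisets are represented by lists and sub-multisets by [subseq]; every
   property of a list used below is invariant under permutation. *)

Definition elem_sym (R : comPzRingType) (m : nat) (S : seq R) : R :=
  \sum_(A : {set 'I_(size S)} | #|A| == m) \prod_(i in A) S`_i.

Definition zero_sum_length (G : finZmodType) (t : nat) : Prop :=
  forall S : seq G, (t <= size S)%N ->
    exists S' : seq G, [/\ subseq S' S, S' != [::] & \sum_(x <- S') x = 0].

Definition zero_elem_sym_length (n m t : nat) : Prop :=
  forall S : seq 'Z_n, (t <= size S)%N ->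
    exists S' : seq 'Z_n,
      [/\ subseq S' S, (m <= size S')%N & elem_sym m S' = 0].

Lemma davenport_exists (G : finZmodType) :
  exists t, (0 < t)%N && `[< zero_sum_length G t >].
Proof.
exists #|G|; apply/andP; split; first by apply/card_gt0P; exists 0.
apply/asboolP => S leS.
pose f (k : 'I_(#|G|.+1)) : G := \sum_(x <- take k S) x.
have /injectivePn [i [j neq_ij eq_f]] : ~~ injectiveb f.
  by apply/negP => /injectiveP /leq_card; rewrite card_ord ltnn.
wlog lt_ij : i j neq_ij eq_f / (i < j)%N => [hwlog|].
  case: (ltngtP i j) => [|gt_ij|/val_inj eq_ij].
  - exact: hwlog.
  - by apply: (hwlog j i) => //; rewrite eq_sym.
  - by rewrite eq_ij eqxx in neq_ij.
have le_jS : (j <= size S)%N by rewrite (leq_trans _ leS) // -ltnS.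
exists (drop i (take j S)); split.
- exact: subseq_trans (drop_subseq _ _) (take_subseq _ _).
- by rewrite -size_eq0 size_drop size_takel // subn_eq0 -ltnNge.
- apply: (@addrI _ (f i)); rewrite addr0 {2}eq_f /f -big_cat /=.
  by rewrite -{1}(take_takel S (ltnW lt_ij)) cat_take_drop.
Qed.

Lemma elem_sym_nseq (R : comPzRingType) (m k : nat) (a : R) :
  elem_sym m (nseq k a) = a ^+ m *+ 'C(k, m).
Proof.
rewrite /elem_sym (eq_bigr (fun=> a ^+ m)) => [|A /eqP cardA].
  rewrite sumr_const -[k in 'C(k, _)](size_nseq k a).
  by rewrite -[X in 'C(X, _)]card_ord -card_draws cardsE.
rewrite -cardA -prodr_const; apply: eq_bigr => i _.
by rewrite nth_nseq -[X in (_ < X)%N](size_nseq k a) ltn_ord.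
Qed.

Lemma elem_sym_davenport_exists (n m : nat) : (0 < m)%N ->
  exists t, (0 < t)%N && `[< zero_elem_sym_length n m t >].
Proof.
move=> m_gt0; pose q := (Zp_trunc n).+2; pose L := (q * m`! + m.-1)%N.
have L_gt0 : (0 < L)%N by rewrite addn_gt0 muln_gt0 fact_gt0.
exists (q * L)%N; rewrite muln_gt0 L_gt0 /=; apply/asboolP => S leS.
have [a le_a] : exists a : 'Z_n, (L <= count_mem a S)%N.
  apply/existsP; rewrite -[X in is_true X]negbK negb_exists; apply/negP.
  move=> /forallP lt_a; suff : (size S < q * L)%N by rewrite ltnNge leS.
  have -> : size S = (\sum_(a : 'Z_n) count_mem a S)%N.
    elim: S {leS lt_a} => [|x S IHS] /=; first by rewrite big1.
    rewrite big_split /= -IHS (bigD1 x) //= eqxx big1 // => b neq_bx.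
    by rewrite eq_sym (negPf neq_bx).
  apply: (@leq_ltn_trans (\sum_(a : 'Z_n) L.-1)%N).
    by apply: leq_sum => a _; rewrite -ltnS (prednK L_gt0) ltnNge; apply: lt_a.
  by rewrite sum_nat_const card_ord ltn_pmul2l // prednK.
have le_mL : (m <= L)%N.
  by rewrite -[leqLHS](prednK m_gt0) -add1n leq_add2r muln_gt0 fact_gt0.
exists (nseq L a); split; last 1 first.
- rewrite elem_sym_nseq -mulr_natr.
  suff /dvdnP [c ->] : (q %| 'C(L, m))%N.
    have q0 : q%:R = 0 :> 'Z_n by apply: val_inj; rewrite Zp_nat /= modnn.
    by rewrite natrM q0 !mulr0.
  rewrite -(@dvdn_pmul2r m`!) ?fact_gt0 // bin_ffact.
  by rewrite -[m in (_ ^_ m)%N](prednK m_gt0) ffactnSr addnK dvdn_mull.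
- have -> : nseq L a = take L (filter (pred1 a) S).
    apply: (@eq_from_nth _ a) => [|i].
      by rewrite size_nseq size_takel // size_filter.
    rewrite size_nseq => lt_iL; rewrite nth_nseq lt_iL nth_take //.
    have : nth a (filter (pred1 a) S) i \in filter (pred1 a) S.
      by rewrite mem_nth // size_filter (leq_trans lt_iL).
    by rewrite mem_filter => /andP [/eqP].
  exact: subseq_trans (take_subseq _ _) (filter_subseq _ _).
- by rewrite size_nseq.
Qed.

Definition davenport (G : finZmodType) : nat := ex_minn (davenport_exists G).

(* For m = 0 no length qualifies, since e_0 = 1. *)
Definition elem_sym_davenport (n m : nat) (m_gt0 : (0 < m)%N) : nat :=
  ex_minn (elem_sym_davenport_exists n m_gt0).

(* The index i : 'I_m stands for i.+1 in {1, ..., m}. *)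
Definition newton_exponents (m : nat) (j : 'I_m -> nat) : Prop :=
  (\sum_(i < m) i.+1 * j i)%N = m.

Definition dominating (m : nat) (T : {set 'I_m}) : Prop :=
  forall j : 'I_m -> nat, newton_exponents j ->
    exists2 i : 'I_m, i \in T & (1 <= j i)%N.

(* The default value m is harmless: it is the size of the full set, which is
   dominating when m > 0, and no subset is larger. *)
Definition min_dominating (m : nat) : nat :=
  \big[minn/m]_(T : {set 'I_m} | `[< dominating T >]) #|T|.

(* Main.v *)
Require Import Defs.
From mathcomp Require Import all_boot all_order all_algebra.
From mathcomp Require Import boolp.
From mathcomp Require Import ring zify.

(** By Newton's identities, [k e_k] is an alternating sum of the products
    [e_(k-i) p_i].  If [T] meets every partition of [k] and the power sums
    indexed by [T] vanish, then each product vanishes: either [i] lies in [T], or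
    [T] meets every partition of [k - i] and [e_(k-i) = 0] by induction.
    It therefore suffices to find a subsequence of length at least [m] whose image
    under [a |-> (a^i)_(i in T)] has sum zero; the Davenport constant yields it
    because disjoint zero-sum subsequences can be merged. *)

Set Implicit Arguments.
Unset Strict Implicit.
Unset Printing Implicit Defensive.

Import GRing.Theory.
Local Open Scope ring_scope.

(** Expanding the product picks a set [A] of positions that contribute [a *: 'X]; degree [m] means
    [#|A| = m]. *)
Lemma elem_sym_coef (R : comNzRingType) (m : nat) (S : seq R) :
  elem_sym m S = (\prod_(a <- S) (1 + a *: 'X))`_m.
Proof.
rewrite (big_nth 0) big_mkord.
under eq_bigr do rewrite addrC.
rewrite bigA_distr coef_sum /elem_sym [LHS]big_mkcond /=.
apply: eq_bigr => A _; rewrite -big_mkcond /= scaler_prod prodr_const.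
by rewrite coefZ coefXn eq_sym mulr_natr mulrb.
Qed.

(** Multiplying by the geometric series of [a / (1 + a X)] undoes the factor [1 + a *: 'X]. *)
Lemma coef_divide_linear (R : comNzRingType) (a : R) (Q : {poly R}) (k : nat) :
  \sum_(i < k.+1) (- 1) ^+ i * ((1 + a *: 'X) * Q)`_(k - i) * a ^+ i.+1
    = a * Q`_k.
Proof.
have coefP j : ((1 + a *: 'X) * Q)`_j = Q`_j + (if j is j'.+1 then a * Q`_j' else 0).
  rewrite mulrDl mul1r coefD -scalerAl coefZ coefXM.
  by case: j => //=; rewrite mulr0.
elim: k => [|k IHk].
  by rewrite big_ord1 coefP /= expr0 addr0 mul1r expr1 mulrC.
rewrite big_ord_recl subn0 coefP expr0 mul1r expr1.
under eq_bigr => i _ do rewrite /bump /= subSS exprS exprSr.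
transitivity ((Q`_k.+1 + a * Q`_k) * a - a * (a * Q`_k)); last by ring.
congr (_ + _); rewrite -IHk mulr_sumr -sumrN; apply: eq_bigr => i _.
by ring.
Qed.

(** Differentiating the generating product omits one factor at a time; [coef_divide_linear] rewrites
    each coefficient in terms of the full product. *)
Lemma newton_identity (R : comNzRingType) (S : seq R) (k : nat) :
  elem_sym k.+1 S *+ k.+1
    = \sum_(i < k.+1) (- 1) ^+ i * elem_sym (k - i) S * \sum_(a <- S) a ^+ i.+1.
Proof.
rewrite elem_sym_coef -coef_deriv.
have derivP : (\prod_(a <- S) (1 + a *: 'X))^`()
   = \sum_(a <- S) a *: \prod_(b <- rem a S) (1 + b *: 'X).
  elim: S => [|a S IHS]; first by rewrite !big_nil derivC.
  rewrite !big_cons derivM IHS /= eqxx derivD derivC derivZ derivX add0r.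
  rewrite -scalerAl mul1r mulr_sumr; congr (_ + _).
  rewrite big_seq [RHS]big_seq; apply: eq_bigr => b bS.
  (* If [a = b], [rem] deletes the head, and the factor for [b] is taken out of [S] instead. *)
  have [->|neq] := eqVneq a b; last by rewrite big_cons -scalerAr.
  by rewrite [in RHS](big_rem _ bS) /= scalerAr.
rewrite derivP coef_sum.
under [RHS]eq_bigr do rewrite mulr_sumr.
rewrite exchange_big big_seq [RHS]big_seq; apply: eq_bigr => a aS /=.
rewrite coefZ -coef_divide_linear; apply: eq_bigr => i _.
by rewrite elem_sym_coef (big_rem _ aS).
Qed.

(** [j i] is the multiplicity of the part [i.+1]; the case [k = m] is [dominating]. *)
Definition partition_hitting (m k : nat) (T : {set 'I_m}) : Prop :=
  forall j : 'I_m -> nat, (\sum_(i < m) i.+1 * j i)%N = k ->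
    exists2 i : 'I_m, i \in T & (1 <= j i)%N.

(** Adding the part [i.+1] gives a partition of [k]; the part that [T] hits there is not the added
    one, as [i] is outside [T]. *)
Lemma partition_hitting_sub (m k : nat) (T : {set 'I_m}) (i : 'I_m) :
  i \notin T -> (i.+1 <= k)%N -> partition_hitting k T ->
  partition_hitting (k - i.+1) T.
Proof.
move=> iT le_ik hitT j sum_j.
have [|l lT] := hitT (fun l => j l + (l == i))%N.
  under eq_bigr do rewrite mulnDr.
  rewrite big_split /= sum_j (bigD1 i) //= eqxx muln1 big1 ?addn0 ?subnK //.
  by move=> l /negPf ->; rewrite muln0.
have /negPf -> : l != i by apply: contraNneq iT => <-.
by rewrite addn0; exists l.
Qed.

Lemma elem_sym_eq0 (R : comUnitRingType) (m k : nat) (T : {set 'I_m})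
    (S : seq R) :
    (forall i, (0 < i <= m)%N -> i%:R \is a @GRing.unit R) ->
    (forall i, i \in T -> \sum_(a <- S) a ^+ i.+1 = 0) ->
  (k <= m)%N -> partition_hitting k T -> elem_sym k S = 0.
Proof.
move=> unitR pT0; elim/ltn_ind: k => -[|k] IHk le_km hitT.
  (* The empty partition of [0] cannot be hit, so [k = 0] is contradictory. *)
  have [|i _ //] := hitT (fun=> 0%N).
  by rewrite big1 // => i _; rewrite muln0.
apply: (mulIr (unitR k.+1 le_km)); rewrite mul0r mulr_natr newton_identity.
apply: big1 => i _; have lt_im := leq_trans (ltn_ord i) le_km.
have [iT|iT] := boolP (Ordinal lt_im \in T); first by rewrite (pT0 _ iT) mulr0.
rewrite IHk ?mulr0 ?mul0r //; first by rewrite ltnS leq_subr.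
  by rewrite (leq_trans (leq_subr _ _)) // ltnW.
by have := partition_hitting_sub iT (ltn_ord i) hitT; rewrite subSS.
Qed.

Lemma long_zero_sum (A : eqType) (G : finZmodType) (f : A -> G) (t m : nat)
    (S : seq A) :
    zero_sum_length G t -> (t + m <= (size S).+1)%N ->
  exists S', [/\ subseq S' S, (m <= size S')%N & \sum_(x <- S') f x = 0].
Proof.
move=> zsG leS.
have [S1 [S2 [permS le_m sum0]]] : exists S1 S2,
    [/\ perm_eq S (S1 ++ S2), (m <= size S1)%N & \sum_(x <- S1) f x = 0].
  elim: m leS => [|m IHm] leS; first by exists [::], S; rewrite big_nil.
  have [|S1 [S2 [permS le_m sum0]]] := IHm; first by lia.
  (* Otherwise [S1] has exactly [m] terms, so [S2] has at least [t] and yields a non-empty zero-sum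
     piece to merge. *)
  have [lt_m|le_S1] := ltnP m (size S1); first by exists S1, S2.
  have [|_ [/subseqP [b size_b ->]]] := zsG (map f S2).
    by have := perm_size permS; rewrite size_cat size_map; lia.
  rewrite -map_mask big_map -size_eq0 size_map => U_neq0 sumU.
  have [S3 permS2] := perm_to_subseq (mask_subseq b S2).
  exists (S1 ++ mask b S2), S3; split; last by rewrite big_cat /= sum0 sumU addr0.
    by rewrite (perm_trans permS) // -catA perm_cat2l.
  by rewrite size_cat; lia.
(* [S1] is only a sub-multiset of [S]; a permutation of it is a genuine subsequence. *)
have /count_subseqP [S' subS' permS'] x : (count_mem x S1 <= count_mem x S)%N.
  by rewrite (permP permS) count_cat leq_addr.
by exists S'; rewrite -(perm_size permS') -(perm_big _ permS').
Qed.

Lemma min_dominating_attained (m : nat) : (0 < m)%N ->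
  exists2 T : {set 'I_m}, dominating T & #|T| = min_dominating m.
Proof.
move=> m_gt0; rewrite /min_dominating.
apply: (big_ind (fun c => exists2 T : {set 'I_m}, dominating T & #|T| = c)).
- exists setT; last by rewrite cardsT card_ord.
  move=> j sum_j; apply/exists2P; apply: contrapT => no_i.
  move: m_gt0; rewrite -sum_j big1 // => i _.
  case: (posnP (j i)) => [->|ji]; first by rewrite muln0.
  by case: no_i; exists i; rewrite inE.
- by move=> c d [T domT <-] [U domU <-]; case: leqP => _; [exists T | exists U].
- by move=> T /asboolP domT; exists T.
Qed.

Theorem theorem20 (n m : nat) (n_ge2 : (2 <= n)%N) (m_gt0 : (0 < m)%N)
    (cop : coprime n m`!) :
  (elem_sym_davenport n m_gt0
    <= davenport 'rV['Z_n]_(min_dominating m) + m - 1)%N.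
Proof.
rewrite /elem_sym_davenport; case: ex_minnP => t _; apply.
rewrite /davenport; case: ex_minnP => d /andP [d_gt0 /asboolP zs_d] _.
apply/andP; split; first by lia.
apply/asboolP => S leS.
have [T domT cardT] := min_dominating_attained m_gt0.
rewrite -cardT in zs_d.
pose f (a : 'Z_n) : 'rV['Z_n]_#|T| := \row_j a ^+ (enum_val (A := T) j).+1.
have [|S' [subS' le_m sum0]] := long_zero_sum f (m := m) (S := S) zs_d.
  by rewrite -add1n -leq_subLR.
exists S'; split=> //; apply: (elem_sym_eq0 (T := T)) => //.
  (* Each such [i] divides [m!], hence is coprime to [n]. *)
  move=> i /andP [i_gt0 le_im]; rewrite unitZpE //.
  by apply: coprime_dvdr cop; apply: dvdn_fact; rewrite i_gt0.
move=> i iT.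
have sum0i : \sum_(a <- S') f a 0 (enum_rank_in iT i) = 0.
  by rewrite -summxE sum0 mxE.
rewrite -[RHS]sum0i; apply: eq_bigr => a _.
by rewrite mxE enum_rankK_in.
Qed.
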